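(* Let $S$ be a finite set, let $\Gamma$ be a Coxeter graph over $S$ with Coxeter matrix $(m_{s,t})_{s,t\in S}$, and let $A(\Gamma)$ be the associated Artin group with standard generators $\{\sigma_s : s\in S\}$. Suppose that an integer $m_s\geq 2$ is given for each $s\in S$. Then the set of elements $\mathcal{T}=\{T_s=\sigma_s^{m_s} : s\in S\}$ generates a subgroup of $A(\Gamma)$ with presentation $$\langle \mathcal{T}\mid T_sT_t=T_tT_s \text{ if } m_{s,t}=2\rangle .$$ That is, the homomorphism to $A(\Gamma)$ from the abstract group with generators $T_s$ ($s\in S$) and defining relations $T_sT_t=T_tT_s$ for all $s,t\in S$ with $m_{s,t}=2$, which sends $T_s$ to $\sigma_s^{m_s}$ for each $s\in S$, is injective.
   Context: A Coxeter matrix over a finite set $S$ is a matrix $M=(m_{s,t})_{s,t\in S}$ with $m_{s,s}=1$ for all $s\in S$ and $m_{s,t}=m_{t,s}\in\{2,3,4,\dots\}\cup\{\infty\}$ for all $s\neq t$. It is represented by its Coxeter graph $\Gamma$: the vertex set is $S$; distinct $s,t$ are joined by an edge iff $m_{s,t}\neq 2$; the edge is labelled $m_{s,t}$ if $m_{s,t}\geq 4$ or $m_{s,t}=\infty$. For letters $a,b$ and $m\in\mathbb{N}$ let $\mathrm{prod}(a,b;m)=(ab)^{m/2}$ if $m$ is even and $(ab)^{(m-1)/2}a$ if $m$ is odd. The Artin group is $$A(\Gamma)=\langle \sigma_s\ (s\in S)\mid \mathrm{prod}(\sigma_s,\sigma_t;m_{s,t})=\mathrm{prod}(\sigma_t,\sigma_s;m_{s,t})\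 \text{for all } s,t\in S \text{ with } m_{s,t}\neq\infty\rangle .$$ *)

(* Defs.v *)
From HB Require Import structures.
From mathcomp Require Import all_boot.
From mathcomp Require Import boolp.

Set Implicit Arguments.
Unset Strict Implicit.
Unset Printing Implicit Defensive.

Local Open Scope quotient_scope.
Local Open Scope group_scope.

(* A letter (x, false) stands for the generator x and (x, true) for x^-1. *)
Definition gword (X : Type) := seq (X * bool).

Definition pos_word (X : Type) (s : seq X) : gword X :=
  [seq (x, false) | x <- s].

Definition inv_word (X : Type) (w : gword X) : gword X :=
  rev [seq (l.1, ~~ l.2) | l <- w].

(* [relations u v] says that u = v is one of the defining relations. *)
Definition relations (X : Type) := gword X -> gword X -> Prop.

(* Two words represent the same element of < X | R > iff they are related by the
   smallest congruence on words that contains R and free cancellation. *)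
Inductive pres_eq (X : Type) (R : relations X) : gword X -> gword X -> Prop :=
| pres_eq_refl u : pres_eq R u u
| pres_eq_sym u v : pres_eq R u v -> pres_eq R v u
| pres_eq_trans u v w : pres_eq R u v -> pres_eq R v w -> pres_eq R u w
| pres_eq_cat u u' v v' :
    pres_eq R u u' -> pres_eq R v v' -> pres_eq R (u ++ v) (u' ++ v')
| pres_eq_cancel x b : pres_eq R [:: (x, b); (x, ~~ b)] [::]
| pres_eq_rel u v : R u v -> pres_eq R u v.

Section PresentedGroup.
Variables (X : choiceType) (R : relations X).

Definition pres_eqb (u v : gword X) : bool := `[< pres_eq R u v >].

Lemma pres_eqb_refl : reflexive pres_eqb.
Proof. by move=> u; apply/asboolP; exact: pres_eq_refl. Qed.

Lemma pres_eqb_sym : symmetric pres_eqb.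
Proof. by move=> u v; apply/asboolP/asboolP; exact: pres_eq_sym. Qed.

Lemma pres_eqb_trans : transitive pres_eqb.
Proof.
move=> v u w /asboolP uv /asboolP vw; apply/asboolP; exact: pres_eq_trans vw.
Qed.

Canonical pres_eqb_equiv :=
  EquivRel pres_eqb pres_eqb_refl pres_eqb_sym pres_eqb_trans.

Definition presented : Type := {eq_quot pres_eqb}.

HB.instance Definition _ := Choice.on presented.
HB.instance Definition _ := Quotient.on presented.

Definition pres_class (w : gword X) : presented := \pi_presented w.

Lemma pres_classP (u v : gword X) :
  pres_class u = pres_class v <-> pres_eq R u v.
Proof.
split=> [/eqquotP/asboolP //|uv].
by apply/eqquotP/asboolP.
Qed.

Lemma pres_class_repr (g : presented) : pres_class (repr g) = g.
Proof. exact: reprK. Qed.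

Lemma pres_eq_repr (w : gword X) : pres_eq R (repr (pres_class w)) w.
Proof. by apply/pres_classP; rewrite pres_class_repr. Qed.

Definition pres_one : presented := pres_class [::].
Definition pres_mul (g h : presented) : presented :=
  pres_class (repr g ++ repr h).
Definition pres_inv (g : presented) : presented :=
  pres_class (inv_word (repr g)).

Lemma pres_class_cat (u v : gword X) :
  pres_class (u ++ v) = pres_mul (pres_class u) (pres_class v).
Proof.
by apply/pres_classP/pres_eq_sym/pres_eq_cat; exact: pres_eq_repr.
Qed.

Lemma pres_eq_invr (w : gword X) : pres_eq R (w ++ inv_word w) [::].
Proof.
elim: w => [|[x b] w IHw]; first exact: pres_eq_refl.
have -> : ((x, b) :: w) ++ inv_word ((x, b) :: w) =
    [:: (x, b)] ++ (w ++ inv_word w) ++ [:: (x, ~~ b)].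
  by rewrite /inv_word /= rev_cons -cats1 !catA.
apply: (@pres_eq_trans _ _ _ ([:: (x, b)] ++ [::] ++ [:: (x, ~~ b)])).
  apply: pres_eq_cat; first exact: pres_eq_refl.
  by apply: pres_eq_cat; [exact: IHw | exact: pres_eq_refl].
exact: pres_eq_cancel.
Qed.

Lemma inv_wordK (w : gword X) : inv_word (inv_word w) = w.
Proof.
rewrite /inv_word map_rev revK -map_comp -[RHS]map_id.
by apply: eq_map => -[x b] /=; rewrite negbK.
Qed.

Lemma pres_mulA : associative pres_mul.
Proof.
move=> a b c; rewrite -[a]pres_class_repr -[b]pres_class_repr.
by rewrite -[c]pres_class_repr -!pres_class_cat catA.
Qed.

Lemma pres_mul1g : left_id pres_one pres_mul.
Proof. by move=> a; rewrite -[a]pres_class_repr -pres_class_cat. Qed.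

Lemma pres_mulg1 : right_id pres_one pres_mul.
Proof. by move=> a; rewrite -[a]pres_class_repr -pres_class_cat cats0. Qed.

Lemma pres_mulgV : right_inverse pres_one pres_inv pres_mul.
Proof.
move=> a; rewrite -{1}[a]pres_class_repr -pres_class_cat.
exact/pres_classP/pres_eq_invr.
Qed.

Lemma pres_mulVg : left_inverse pres_one pres_inv pres_mul.
Proof.
move=> a; rewrite -{2}[a]pres_class_repr -pres_class_cat; apply/pres_classP.
by rewrite -{2}[repr a]inv_wordK; exact: pres_eq_invr.
Qed.

HB.instance Definition _ :=
  isGroup.Build presented
    pres_mulA pres_mul1g pres_mulg1 pres_mulVg pres_mulgV.

Definition pres_gen (x : X) : presented := pres_class [:: (x, false)].

Definition eval_word (G : groupType) (f : X -> G) (w : gword X) : G :=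
  \prod_(l <- w) (if l.2 then (f l.1)^-1 else f l.1).

Lemma eval_word_cat (G : groupType) (f : X -> G) (u v : gword X) :
  eval_word f (u ++ v) = eval_word f u * eval_word f v.
Proof. by rewrite /eval_word big_cat. Qed.

Lemma pres_class_eval (w : gword X) : pres_class w = eval_word pres_gen w.
Proof.
elim: w => [|[x b] w IHw]; first by rewrite /eval_word big_nil.
rewrite -cat1s pres_class_cat eval_word_cat -IHw.
congr (_ * _); rewrite /eval_word big_seq1 /=; case: b => //.
apply/(@mulgI _ (pres_gen x)); rewrite mulgV -[LHS]pres_class_cat.
by apply/pres_classP; exact: pres_eq_cancel.
Qed.

Lemma pres_hom_word (G : groupType) (f : {multiplicative presented -> G})
    (w : gword X) :
  f (pres_class w) = eval_word (f \o pres_gen) w.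
Proof.
have f1 : f 1 = 1 by apply/(@mulgI _ (f 1)); rewrite -gmulfM !mulg1.
have fV g : f g^-1 = (f g)^-1.
  by apply/(@mulgI _ (f g)); rewrite -gmulfM !mulgV.
rewrite pres_class_eval; elim: w => [|[x b] w IHw].
  by rewrite /eval_word !big_nil.
rewrite -cat1s !eval_word_cat gmulfM IHw; congr (_ * _).
by rewrite /eval_word !big_seq1 /=; case: b.
Qed.

Lemma pres_hom_ext (G : groupType) (f g : {multiplicative presented -> G}) :
  (forall x, f (pres_gen x) = g (pres_gen x)) -> f =1 g.
Proof.
move=> fg a; rewrite -[a]pres_class_repr !pres_hom_word /eval_word.
by apply: eq_bigr => l _ /=; rewrite fg.
Qed.

Lemma eval_word_pres_eq (G : groupType) (f : X -> G) :
  (forall u v, R u v -> eval_word f u = eval_word f v) ->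
  forall u v, pres_eq R u v -> eval_word f u = eval_word f v.
Proof.
move=> fR u v; elim=> {u v} [//|//|u v w _ -> _ -> //| | |u v /fR //].
  by move=> u u' v v' _ eu _ ev; rewrite !eval_word_cat eu ev.
move=> x b; rewrite /eval_word !big_cons !big_nil mulg1 /=.
by case: b => /=; rewrite ?mulVg ?mulgV.
Qed.

Lemma pres_lift (G : groupType) (f : X -> G) :
  (forall u v, R u v -> eval_word f u = eval_word f v) ->
  exists phi : {multiplicative presented -> G},
    forall x, phi (pres_gen x) = f x.
Proof.
move=> fR; pose h (g : presented) := eval_word f (repr g).
have hE w : h (pres_class w) = eval_word f w.
  by apply: (eval_word_pres_eq fR); exact: pres_eq_repr.
have hM : {morph h : x y / x * y}.
  by move=> a b; rewrite [RHS]/(_ * _) -[RHS]eval_word_cat -hE.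
pose hm := isMultiplicative.Build _ _ h hM.
pose phi : {multiplicative presented -> G} := HB.pack h hm.
by exists phi => x; rewrite /= hE /eval_word big_seq1.
Qed.

End PresentedGroup.

(* [None] encodes the value infinity. The Coxeter graph carries the same data as
   the matrix, so it is not represented separately. *)
Record coxeter_matrix (S : finType) := CoxeterMatrix {
  cox_entry :> S -> S -> option nat;
  cox_diag : forall s, cox_entry s s = Some 1%N;
  cox_sym : forall s t, cox_entry s t = cox_entry t s;
  cox_offdiag : forall s t k,
    s != t -> cox_entry s t = Some k -> (2 <= k)%N
}.

(* (ab)^(m/2) if m is even, (ab)^((m-1)/2) a if m is odd. *)
Definition alt_prod (T : Type) (a b : T) (m : nat) : seq T :=
  flatten (nseq m./2 [:: a; b]) ++ nseq (odd m) a.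

Definition artin_rel (S : finType) (M : coxeter_matrix S) : relations S :=
  fun u v => exists s t k,
    [/\ M s t = Some k,
        u = pos_word (alt_prod s t k) & v = pos_word (alt_prod t s k)].

Definition artin_group (S : finType) (M : coxeter_matrix S) : Type :=
  presented (artin_rel M).

HB.instance Definition _ (S : finType) (M : coxeter_matrix S) :=
  Group.on (artin_group M).

Definition artin_gen (S : finType) (M : coxeter_matrix S) (s : S) :
  artin_group M := pres_gen (artin_rel M) s.

(* The generators T_s are indexed by s : S. *)
Definition commutation_rel (S : finType) (M : coxeter_matrix S) : relations S :=
  fun u v => exists s t,
    [/\ M s t = Some 2%N,
        u = pos_word [:: s; t] & v = pos_word [:: t; s]].

Definition commutation_group (S : finType) (M : coxeter_matrix S) : Type :=
  presented (commutation_rel M).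

HB.instance Definition _ (S : finType) (M : coxeter_matrix S) :=
  Group.on (commutation_group M).

Definition commutation_gen (S : finType) (M : coxeter_matrix S) (s : S) :
  commutation_group M := pres_gen (commutation_rel M) s.

(* Main.v *)
From HB Require Import structures.
Require Import Defs.
From mathcomp Require Import all_boot.
From mathcomp Require Import ssralg ssrint boolp zify.

Set Implicit Arguments.
Unset Strict Implicit.
Unset Printing Implicit Defensive.

(** The homomorphism exists because powers of commuting elements commute;
    what has to be proved is that it is injective. The Artin group is made to
    act on the paths of a surface by Dehn twists, in such a way that a
    product of powers of the generators visibly moves a path.

    The surface. Unfold the Coxeter graph to a graph whose vertices are the
    pairs (x, i), with x a generator or an extra cone vertex and i a natural
    number. If m_(s,t) = n + 1, the natural numbers are cut into blocks of
    length n, and (s, i) is joined to (t, j) when i and j are consecutive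
    numbers of one block; so the vertices over s and t form chains with n
    vertices. A label infinity carries no relation and is treated like 3.
    Take one circle for each vertex, let circles of adjacent vertices cross
    once, and thicken: the arcs of circles between successive crossings
    freely generate the fundamental groupoid of the resulting surface. The
    generator s acts by the Dehn twists along all circles (s, i)
    simultaneously. Twists along two crossing circles satisfy the braid
    relation [twist_braid]; in a chain of n circles, the products of the
    twists at even and at odd positions then satisfy the relation of length n
    + 1 [dihedral_braid]; so the Artin relations hold [gen_act_braid]. It is
    convenient to let the twists act on the labellings of the arcs by the
    elements of an arbitrary group. For the labelling of the arcs by free
    generators this is the action on words in the arcs [eval_word_twist].

    Injectivity. Write an element of the commutation group as a product of as
    few syllables T_s^k as possible. If one starts at the first syllable and
    repeatedly moves to the first later syllable that does not commute with
    the present one, then the generator changes at every move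
    [syl_prod_normal]. A twist along u changes a reduced path only by
    inserting powers of the loop around u where the path crosses u, and no
    arc of another circle is cancelled [red_subst]. Suppose that a path
    somewhere runs along a circle v straight through the crossing with u. The
    K-th power of the twist along u inserts the K-th power of the loop around
    u at this place. If K is at least 2 in absolute value, as it is for K = k
    m_s, this power in turn runs along u straight through every crossing on u
    [passes_create], and syllables commuting with that of u leave this
    unchanged [passes_persist]. So the property moves along the chosen
    syllables, and a path that lies on the circle of a cone vertex is sent to
    one that contains arcs over the generators [winding_survives]. *)

Import GRing.Theory.
Local Open Scope group_scope.

(** * Integer powers in a group *)

Definition expgz (G : groupType) (g : G) (k : int) : G :=
  match k with Posz n => g ^+ n | Negz n => g ^- n.+1 end.

Lemma expgz0 (G : groupType) (g : G) : expgz g 0 = 1.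
Proof. by []. Qed.

Lemma expgzS (G : groupType) (g : G) (k : int) :
  expgz g (1 + k)%R = g * expgz g k.
Proof.
case: k => [n|[|n]]; first exact: expgS.
  by rewrite /= expg1 mulgV.
have -> : (1 + Negz n.+1)%R = Negz n.
  by rewrite !NegzE -[in LHS]add1n PoszD opprD addrA subrr add0r.
by rewrite /= [in RHS]expgSr invgM mulVKg.
Qed.

Lemma expgzD (G : groupType) (g : G) (j k : int) :
  expgz g (j + k)%R = expgz g j * expgz g k.
Proof.
elim/int_ind: j => [|n IHn|n IHn].
- by rewrite add0r mul1g.
- by rewrite -add1n PoszD -addrA !expgzS IHn mulgA.
- apply: (mulgI g); rewrite mulgA -!expgzS addrA.
  suff -> : (1 + - (Posz n.+1))%R = (- Posz n)%R by exact: IHn.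
  by rewrite -add1n PoszD opprD addrA subrr add0r.
Qed.

Lemma expgzN (G : groupType) (g : G) (k : int) :
  expgz g (- k)%R = (expgz g k)^-1.
Proof. by apply/esym/mulg1_eq; rewrite -expgzD addrN. Qed.

Lemma expgz1 (G : groupType) (g : G) : expgz g 1 = g.
Proof. exact: expg1. Qed.

Lemma expgzM (G : groupType) (g : G) (n : nat) (k : int) :
  expgz (g ^+ n) k = expgz g (n%:Z * k)%R.
Proof.
have pos i : (g ^+ n) ^+ i = expgz g (n%:Z * i%:Z)%R.
  by rewrite -PoszM -expgnA.
case: k => i; first exact: pos.
by rewrite NegzE mulrN !expgzN -pos.
Qed.

Lemma commute_expgz (G : groupType) (g h : G) (j k : int) :
  commute g h -> commute (expgz g j) (expgz h k).
Proof.
have half (x y : G) i : commute x y -> commute x (expgz y i).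
  by case: i => n xy; [exact: commuteX | apply: commuteV; exact: commuteX].
by move=> gh; apply/half/commute_sym/half/commute_sym.
Qed.

(** * Twists along the vertices of a graph *)

(** Under composition. Twists are used as elements of this monoid; their
    inverses are twists again, by [twistD] and [twist0]. *)
Definition selfmap (X : Type) : Type := X -> X.

HB.instance Definition _ (X : choiceType) := Choice.on (selfmap X).
HB.instance Definition _ (X : choiceType) :=
  @isMonoid.Build (selfmap X) (fun f g => fun x => f (g x)) (fun x => x)
    (fun f g h => erefl) (fun f => erefl) (fun f => erefl).

Section Twist.
Variables (V : choiceType) (N : V -> seq V).
Hypothesis N_uniq : forall v, uniq (N v).
Hypothesis N_sym : forall v w, (w \in N v) = (v \in N w).

(** The circle u crosses the circles of the vertices in N u, in the cyclic
    order of this list; [cyc u t] lists them from t on. *)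
Definition cyc (u t : V) : seq V := rot (index t (N u)) (N u).

Lemma cyc_uniq u t : uniq (cyc u t).
Proof. by rewrite rot_uniq. Qed.

Lemma mem_cyc u t w : (w \in cyc u t) = (w \in N u).
Proof. by rewrite mem_rot. Qed.

Lemma cyc_head u t : t \in N u -> exists l, cyc u t = t :: l.
Proof. by move=> tN; rewrite /cyc (rot_index tN); eexists. Qed.

Lemma rot_cons_index (T : eqType) (s l : seq T) i x :
  uniq s -> rot i s = x :: l -> rot (index x s) s = x :: l.
Proof.
move=> Us Ei; case: (ltnP i (size s)) => [lt_is|le_si]; last first.
  by move: Ei; rewrite rot_oversize // => ->; rewrite /= eqxx rot0.
have Ex : nth x s i = x.
  have : nth x (rot i s) 0 = x by rewrite Ei.
  by rewrite /rot nth_cat size_drop subn_gt0 lt_is nth_drop addn0.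
by rewrite -{1}Ex index_uniq.
Qed.

(** The loops around u based at w and at t differ by conjugation by the
    segment w :: l1. *)
Lemma cyc_split u w t : w \in N u -> t \in N u -> w != t ->
  exists l1 l2, cyc u w = w :: l1 ++ t :: l2 /\ cyc u t = t :: l2 ++ w :: l1.
Proof.
move=> wN tN wt; have Uu := N_uniq u.
case: (rot_to_arc Uu wN tN wt) => i l1 l2 _ _ Ei.
exists l1, l2; split; first exact: rot_cons_index Ei.
rewrite /cyc; have Ej : rot (size (w :: l1)) (rot i (N u)) = t :: l2 ++ w :: l1.
  by rewrite Ei -cat_cons rot_size_cat.
by rewrite rot_rot_add in Ej; exact: rot_cons_index Ej.
Qed.

Section Maps.
Variable G : groupType.
(** The pair (v, t) stands for the arc of the circle v from its crossing with
    t to the next crossing. *)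
Definition labelling := (V * V)%type -> G.
Implicit Types (x : labelling) (e f : V -> int).

Definition circuit x u t : G := \prod_(w <- cyc u t) x (u, w).

(** A Dehn twist to the power e u along each circle u. The arc (t, u) starts
    by crossing u, and there it picks up the loop around u. General exponents
    let one formula cover powers, inverses and products of disjoint twists. *)
Definition twist e : selfmap labelling := fun x p =>
  (if p.1 \in N p.2 then expgz (circuit x p.2 p.1) (e p.2) else 1) * x p.

Lemma twist_id e x u w : e w = 0%R -> twist e x (u, w) = x (u, w).
Proof. by move=> ew; rewrite /twist /= ew if_same mul1g. Qed.

Lemma circuit_twist_id e x u t :
  (forall w, w \in N u -> e w = 0%R) -> circuit (twist e x) u t = circuit x u t.
Proof.
move=> eN; apply: eq_big_seq => w; rewrite mem_cyc => wN.
by rewrite twist_id ?eN.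
Qed.

(** No circle twisted by e crosses one twisted by f, so the loops that e
    inserts are not changed by f. *)
Lemma twistD e f :
  (forall u v, e u != 0%R -> f v != 0%R -> v \notin N u) ->
  twist e * twist f = twist (fun v => e v + f v)%R.
Proof.
move=> ef; apply/funext => x; apply/funext => -[t u].
rewrite [LHS]/(twist e (twist f x) (t, u)) /twist /=.
case: ifP => _; last by rewrite !mul1g.
have [-> | eu] := eqVneq (e u) 0%R; first by rewrite add0r mul1g.
rewrite expgzD mulgA; congr (expgz _ _ * _ * _).
apply: circuit_twist_id => w wN; apply/eqP; apply: contraTT wN => fw.
exact: ef.
Qed.

Lemma twist0 : twist (fun=> 0%R) = 1.
Proof.
apply/funext => x; apply/funext => p.
by rewrite /twist expgz0 if_same mul1g.
Qed.

Definition independent e :=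
  forall u v, e u != 0%R -> e v != 0%R -> v \notin N u.

(** Each circle twisted by e crosses exactly one circle twisted by f. Twists
    in the same direction have opposite exponents here: if u crosses w from
    left to right, then w crosses u from right to left. *)
Definition matched e f := forall u, e u != 0%R ->
  (e u = 1%R \/ e u = (-1)%R) /\
  exists w, [/\ w \in N u, f w = (- e u)%R &
                forall v, v \in N u -> f v != 0%R -> v = w].

Lemma independent_nbr e u w :
  independent e -> e u != 0%R -> w \in N u -> e w = 0%R.
Proof. by move=> ei eu wN; apply/eqP; apply: contraTT wN => /(ei _ _ eu). Qed.

Lemma prod_twist_id e x u (l : seq V) :
  (forall w, w \in l -> e w = 0%R) ->
  \prod_(w <- l) twist e x (u, w) = \prod_(w <- l) x (u, w).
Proof. by move=> el; apply: eq_big_seq => w /el ew; rewrite twist_id. Qed.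

Lemma prod_twist_match f x u w (l : seq V) :
  uniq (w :: l) -> {subset w :: l <= N u} ->
  (forall v, v \in N u -> f v != 0%R -> v = w) ->
  \prod_(v <- w :: l) twist f x (u, v) =
    expgz (circuit x w u) (f w) * \prod_(v <- w :: l) x (u, v).
Proof.
move=> /= /andP[wl _] lN fw; rewrite !big_cons mulgA; congr (_ * _).
  by rewrite /twist /= -N_sym lN ?mem_head.
apply: prod_twist_id => v vl; apply/eqP; apply: contraNT wl => fv.
by rewrite -(fw v) // lN // inE vl orbT.
Qed.

Lemma circuit_twist_match f x u w :
  w \in N u -> (forall v, v \in N u -> f v != 0%R -> v = w) ->
  circuit (twist f x) u w = expgz (circuit x w u) (f w) * circuit x u w.
Proof.
move=> wN fw; have [l El] := cyc_head wN.
rewrite {1 3}/circuit El prod_twist_match //; first by rewrite -El cyc_uniq.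
by move=> v; rewrite -El mem_cyc.
Qed.

(** Let A and B be the loops around u and its partner w, based at their
    crossing, and let eps = e u. Twisting by e replaces B with A^eps B, and
    twisting by f replaces A with B^-eps A. The loop around u based at t is
    the conjugate of A by a segment R of u; the first arc of R is (u, w), so
    that f multiplies R by B^-eps as well, and the relation becomes an
    identity in A, B and R. *)
Lemma braid_at e f x t u :
  independent e -> matched e f -> matched f e -> f u = 0%R ->
  e u != 0%R -> t \in N u ->
  twist e (twist f (twist e x)) (t, u) = twist f (twist e (twist f x)) (t, u).
Proof.
move=> ei ef fe fu eu tN; have [e1 [w [wN fw fuq]]] := ef u eu.
have [_ [u' [u'N _ euq]]] : (f w = 1%R \/ f w = (-1)%R) /\
    exists u', [/\ u' \in N w, e u' = (- f w)%R &
                forall v, v \in N w -> e v != 0%R -> v = u'].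
  by apply: fe; rewrite fw oppr_eq0.
have uN : u \in N w by rewrite N_sym.
have {u' u'N} euq v : v \in N w -> e v != 0%R -> v = u.
  by move=> vN ev; rewrite (euq v) // [RHS](euq u).
have eN v : v \in N u -> e v = 0%R by exact: independent_nbr.
have twE y : twist e y (t, u) = expgz (circuit y u t) (e u) * y (t, u).
  by rewrite /twist /= tN.
rewrite [RHS]twist_id // !twE [in LHS]twist_id // [in RHS]twist_id // twE.
have Ce y : circuit (twist e y) w u =
    expgz (circuit y u w) (e u) * circuit y w u.
  exact: circuit_twist_match.
have Cf y : circuit (twist f y) u w =
    expgz (circuit y w u) (f w) * circuit y u w.
  exact: circuit_twist_match.
have Cee y : circuit (twist e y) u w = circuit y u w by exact: circuit_twist_id.
move: (x (t, u)) => z; have [<- | wt] := eqVneq w t.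
  rewrite !(Ce, Cf, Cee) fw.
  move: (circuit x u w) (circuit x w u) => A B.
  case: e1 => ->; rewrite ?opprK ?expgzN !expgz1.
    by rewrite !(invgM, mulgA, mulgVK, mulgK).
  by rewrite !(invgM, invgK, mulgA, mulgVK, mulgK, mulVg, mul1g).
have [l1 [l2 [Ew Et]]] := cyc_split wN tN wt.
pose P (y : labelling) : G := \prod_(v <- w :: l1) y (u, v).
have Ct y : circuit y u t = (P y)^-1 * circuit y u w * P y.
  rewrite /circuit Et Ew -[t :: l2 ++ _]/((t :: l2) ++ _) -cat_cons !big_cat /=.
  by rewrite -/(P y) mulgA mulVg mul1g.
have lN : {subset w :: l1 <= N u}.
  by move=> v vl; rewrite -(mem_cyc u w) Ew -cat_cons mem_cat vl.
have Pf y : P (twist f y) = expgz (circuit y w u) (f w) * P y.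
  apply: prod_twist_match => //.
  by have := cyc_uniq u w; rewrite Ew -cat_cons cat_uniq => /and3P[].
have Pe y : P (twist e y) = P y.
  by apply: prod_twist_id => v /lN /eN.
rewrite !(Ct, Ce, Cf, Cee, Pe, Pf) fw.
move: (circuit x u w) (circuit x w u) (P x) => A B R.
case: e1 => ->; rewrite ?opprK ?expgzN !expgz1.
  by rewrite !(invgM, invgK, mulgA, mulgVK, mulgK, mulVg, mul1g).
by rewrite !(invgM, invgK, mulgA, mulgVK, mulgK, mulVg, mul1g).
Qed.

Lemma twist_braid e f :
  independent e -> independent f -> matched e f -> matched f e ->
  (forall u, e u != 0%R -> f u = 0%R) ->
  twist e * twist f * twist e = twist f * twist e * twist f.
Proof.
move=> ei fi ef fe disj; apply/funext => x; apply/funext => -[t u].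
rewrite -[LHS]/(twist e (twist f (twist e x)) (t, u)).
rewrite -[RHS]/(twist f (twist e (twist f x)) (t, u)).
have [tN | tN] := boolP (t \in N u); last first.
  by rewrite /twist /= (negPf tN) !mul1g.
have [eu | eu] := eqVneq (e u) 0%R; last by apply: braid_at; rewrite ?disj.
have [fu | fu] := eqVneq (f u) 0%R; first by rewrite !twist_id.
by apply/esym/braid_at.
Qed.

End Maps.
End Twist.

(** * The braid relation of length n + 1 in a chain of n generators *)

(** [W I] is to be thought of as the product of the generators s_i for i in I
    and i < n, where I contains no two consecutive numbers. Indexing by
    predicates makes an infinite product of disjoint twists a single element. *)
Section Dihedral.
Variables (H : monoidType) (n : nat) (W : pred nat -> H).
Definition far (I J : pred nat) :=
  forall i j, I i -> J j -> i.+1 < j \/ j.+1 < i.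
Hypothesis W_ext : forall I J, (forall i, i < n -> I i = J i) -> W I = W J.
Hypothesis W_0 : W xpred0 = 1.
Hypothesis W_U : forall I J, far I J -> W (predU I J) = W I * W J.
Hypothesis W_braid : forall i, i.+1 < n ->
  W (pred1 i) * W (pred1 i.+1) * W (pred1 i) =
  W (pred1 i.+1) * W (pred1 i) * W (pred1 i.+1).

Notation s i := (W (pred1 i)).

Lemma W_UE K I J : far I J -> (forall i, i < n -> K i = I i || J i) ->
  W K = W I * W J.
Proof. by move=> IJ KE; rewrite -W_U //; apply: W_ext. Qed.

Lemma W_C I J : far I J -> W I * W J = W J * W I.
Proof.
move=> IJ; rewrite -!W_U //; last by move=> i j Ii Jj; case: (IJ j i); auto.
by apply: W_ext => i _; exact: orbC.
Qed.

Definition row a j : pred nat := fun i => (a <= i) && (odd i == odd j).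
Definition low a l : pred nat :=
  fun i => (a <= i < a + l) && (odd i != odd (a + l)).
Definition high j : pred nat := fun i => (j < i) && (odd i == odd j).
Definition rows a j l : H := \prod_(k < l) W (row a (j + k)).
Definition sweep a l : H := \prod_(k < l) s (a + k).

Lemma sweepC a l (I : pred nat) : (forall i, I i -> a + l < i) ->
  sweep a l * W I = W I * sweep a l.
Proof.
move=> Il; apply/commute_sym/commute_prod => k _.
by apply: W_C => i j /Il li /= /eqP ->; have := ltn_ord k; lia.
Qed.

(** By the braid relation, s_i with a <= i < a + l becomes s_(i+1) when it is
    pulled through s_a ... s_(a+l). *)
Lemma sweep_low a l : a + l < n ->
  sweep a l.+1 * W (low a l) = W (low a.+1 l) * sweep a l.+1.
Proof.
have low0 b : W (low b 0) = 1.
  by rewrite -W_0; apply: W_ext => i _; rewrite /low; lia.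
have low1 b : W (low b 1) = s b.
  by apply: W_ext => i _; rewrite /low /=; lia.
have lowSS b k : W (low b k.+2) = s (b + k).+1 * W (low b k).
  apply: W_UE => [i j /= /eqP -> | i _]; first by rewrite /low; lia.
  by rewrite /low /=; lia.
have [k] := ubnP l; elim: k l => // k IHk [|[|l]] lk aln.
- by rewrite !low0 mul1g mulg1.
- rewrite !low1 /sweep !big_ord_recr /= big_ord0 mul1g addn0 addn1.
  by rewrite mulgA W_braid // -addn1.
rewrite !lowSS /sweep 2!big_ord_recr /= -/(sweep a l.+1) !addnS addSn.
set x := W (pred1 (a + l).+1); set y := W (pred1 (a + l).+2).
have cx : x * W (low a l) = W (low a l) * x.
  by apply: W_C => i j /= /eqP ->; rewrite /low; lia.
have cy : y * W (low a l) = W (low a l) * y.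
  by apply: W_C => i j /= /eqP ->; rewrite /low; lia.
have cd : sweep a l.+1 * y = y * sweep a l.+1.
  by apply: sweepC => i /= /eqP ->; lia.
rewrite -!mulgA (mulgA x) (mulgA (x * y)) W_braid; last by lia.
rewrite -!mulgA cy (mulgA x) cx !mulgA.
rewrite cd -[_ * _ * W (low a l)]mulgA IHk; [|lia|lia].
by rewrite !mulgA.
Qed.

Lemma row_split a l :
  W (row a (a + l).+1) = W (high (a + l).+1) * (W (low a l) * s (a + l).+1).
Proof.
rewrite -W_U; last by move=> i j; rewrite /low /= => ? /eqP ->; lia.
by apply: W_UE => [i j | i _]; rewrite /high /low /row /=; lia.
Qed.

Lemma row_split_next a l :
  W (row a.+1 (a + l)) = W (high (a + l)) * W (low a.+1 l).
Proof.
by apply: W_UE => [i j | i _]; rewrite /high /low /row /=; lia.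
Qed.

(** Read the product as a braid: s_i crosses the strands at positions i and i
    + 1, and there is one row of crossings for each factor. The strand that
    starts at position a moves one place to the right in each row, and its
    crossings form the sweep. The crossings to the right of this strand can
    be moved before the sweep; those to its left can be pulled through the
    sweep, which shifts them by one. What remains is the braid of the other
    strands, except that the last row lacks its left part. *)
Lemma rows_peel a l : a + l < n ->
  rows a a l.+1 = rows a.+1 a l * W (high (a + l)) * sweep a l.+1.
Proof.
elim: l => [|l IHl] aln.
  rewrite /rows /sweep !big_ord_recr !big_ord0 /= !mul1g !addn0.
  by apply: W_UE => [i j | i _]; rewrite /high /row /=; lia.
rewrite /rows big_ord_recr -/(rows a a l.+1) /= IHl; last by lia.
rewrite [in RHS]big_ord_recr -/(rows a.+1 a l) /= row_split_next !addnS.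
rewrite row_split.
rewrite /sweep [in RHS]big_ord_recr -/(sweep a l.+1) /= addnS.
rewrite -!mulgA; congr (_ * (_ * _)).
rewrite [LHS]mulgA (@sweepC _ _ (high _)); last by move=> i; rewrite /high; lia.
rewrite -[LHS]mulgA (mulgA (sweep a l.+1)) sweep_low; last by lia.
rewrite !mulgA; congr (_ * _ * _).
by apply: W_C => i j; rewrite /low /high; lia.
Qed.

Lemma rows_shift2 a j l : rows a j.+2 l = rows a j l.
Proof.
apply: eq_bigr => k _; congr W; apply/funext => i.
by rewrite /row !addSn /= negbK.
Qed.

(** Both products end with the same sweep, and what precedes it is the same
    pair of products, exchanged, for a chain with one generator less. *)
Lemma dihedral_braid a p : a + p = n -> rows a a p.+1 = rows a a.+1 p.+1.
Proof.
elim: p a => [|p IHp] a apn.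
  have row1 j : W (row a j) = 1.
    by rewrite -W_0; apply: W_ext => i; rewrite /row; lia.
  by rewrite /rows !big_ord_recr !big_ord0 /= !row1.
have high1 : W (high (a + p)) = 1.
  by rewrite -W_0; apply: W_ext => i; rewrite /high; lia.
have peel : rows a a p.+1 = rows a.+1 a p * sweep a p.+1.
  by rewrite rows_peel ?high1 ?mulg1 //; lia.
have lastrow : W (row a (a + p.+1)) = W (low a p).
  by apply: W_ext => i; rewrite /row /low; lia.
have -> : rows a a p.+2 = rows a.+1 a p.+1 * sweep a p.+1.
  rewrite {1}/rows big_ord_recr -/(rows a a p.+1) /= peel lastrow -mulgA.
  rewrite sweep_low; last by lia.
  rewrite mulgA /rows [in RHS]big_ord_recr /= row_split_next high1 mul1g.
  by [].
have -> : rows a a.+1 p.+2 = rows a.+1 a.+1 p.+1 * sweep a p.+1.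
  have first_row b q : rows b a.+1 q.+1 = W (row b a.+1) * rows b a q.
    rewrite /rows big_ord_recl addn0; congr (_ * _).
    rewrite -[RHS]rows_shift2; apply: eq_bigr => k _.
    by rewrite /= !addSn addnS.
  rewrite (first_row a) peel first_row !mulgA; congr (_ * _ * _).
  by apply: W_ext => i; rewrite /row; lia.
by rewrite -(rows_shift2 a.+1 a) IHp //; lia.
Qed.
End Dihedral.

(** * The unfolded graph and the action of the Artin group *)

Lemma alt_prodE (T : Type) (a b : T) m :
  alt_prod a b m = mkseq (fun j => if odd j then b else a) m.
Proof.
have E k : flatten (nseq k [:: a; b]) =
    mkseq (fun j => if odd j then b else a) k.*2.
  elim: k => // k IHk; rewrite -[in LHS]addn1 nseqD flatten_cat IHk /=.
  by rewrite doubleS !mkseqS /= odd_double /= -!cats1 -catA.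
rewrite -[in RHS](odd_double_half m) addnC /alt_prod E.
by case: (odd m); rewrite /= ?cats0 ?addn0 // addn1 mkseqS odd_double cats1.
Qed.

(** Maps of the generators and of their inverses into a monoid extend to the
    presented group. *)
Lemma pres_eq_prod (X : Type) (R : relations X) (H : monoidType)
    (f : X * bool -> H) :
  (forall x b, f (x, b) * f (x, ~~ b) = 1) ->
  (forall u v, R u v -> \prod_(l <- u) f l = \prod_(l <- v) f l) ->
  forall u v, pres_eq R u v -> \prod_(l <- u) f l = \prod_(l <- v) f l.
Proof.
move=> fV fR u v; elim=> {u v} [//|//|u v w _ -> _ -> //| | |u v /fR //].
  by move=> u u' v v' _ eu _ ev; rewrite !big_cat eu ev.
by move=> x b; rewrite !big_cons !big_nil mulg1.
Qed.

Lemma modS_same_div n q : q %/ n = q.+1 %/ n -> q.+1 %% n = (q %% n).+1.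
Proof.
by move=> E; have := divn_eq q n; have := divn_eq q.+1 n; rewrite -E; lia.
Qed.

Lemma div_modS n q : (q %% n).+1 < n -> q %/ n = q.+1 %/ n.
Proof.
move=> qn; have n_gt0 : 0 < n by lia.
rewrite [in RHS](divn_eq q n) -addnS divnMDl // (@divn_small (q %% n).+1) //.
by rewrite addn0.
Qed.

Lemma pred_mod n p : 0 < n -> 0 < p.+1 %% n -> (p %% n).+1 < n.
Proof.
move=> n_gt0 pn; have := ltn_pmod p n_gt0; rewrite leq_eqVlt => /orP[/eqP E|//].
have pE : p.+1 = ((p %/ n).+1 * n)%N.
  by have := divn_eq p n; rewrite mulSn; lia.
by move: pn; rewrite pE modnMl.
Qed.

Section Unfolding.
Variables (S : finType) (M : coxeter_matrix S).

(** The cone vertices (None, i) give every vertex over a generator a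
    neighbour, and no generator twists along their circles. *)
Definition vertex : choiceType := (option S * nat)%type.

(** The number of vertices in a chain over x and y. *)
Definition block (x y : option S) : nat :=
  if x is Some s then if y is Some t then
    if M s t is Some k then k.-1 else 2 else 2 else 2.

(** For the label 2 the blocks have length 1, so that there is no edge over
    commuting generators. *)
Definition adj (v w : vertex) : bool :=
  [&& v.1 != w.1, (w.2 == v.2.+1) || (v.2 == w.2.+1)
    & v.2 %/ block v.1 w.1 == w.2 %/ block v.1 w.1].

Definition nbrs (v : vertex) : seq vertex :=
  [seq w <- [seq (x, i) | x <- enum {: option S}, i <- [:: v.2.+1; v.2.-1]]
     | adj v w].

Lemma blockC x y : block x y = block y x.
Proof. by case: x y => [s|] [t|] //=; rewrite cox_sym. Qed.

Lemma adjC v w : adj v w = adj w v.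
Proof. by rewrite /adj eq_sym orbC blockC [X in [&& _, _ & X]]eq_sym. Qed.

Lemma nbrs_uniq v : uniq (nbrs v).
Proof.
apply/filter_uniq/allpairs_uniq; first exact: enum_uniq.
- by rewrite /= inE andbT; lia.
- by move=> [a b] [c d].
Qed.

Lemma mem_nbrs v w : (w \in nbrs v) = adj v w.
Proof.
rewrite mem_filter; case: w => x i; case: (boolP (adj v (x, i))) => [vw|//].
apply/allpairsPdep; exists x, i; split=> //=; first by rewrite mem_enum.
move: vw; rewrite !inE /adj /= => /and3P[_ /orP[] /eqP -> _];
  by rewrite eqxx ?orbT.
Qed.

Lemma nbrs_sym v w : (w \in nbrs v) = (v \in nbrs w).
Proof. by rewrite !mem_nbrs adjC. Qed.

(** Adjacent vertices have second coordinates of different parity, hence the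
    opposite signs that [matched] requires. *)
Definition sgn (i : nat) : int := if odd i then (-1)%R else 1%R.

Definition weight (D : pred vertex) (k : int) (v : vertex) : int :=
  if D v then (sgn v.2 * k)%R else 0%R.

Variable G : groupType.
Notation Tw := (@twist vertex nbrs G).

Lemma weight_neq0 D k v : weight D k v != 0%R -> D v.
Proof. by rewrite /weight; case: (D v); rewrite ?eqxx. Qed.

Definition apart (D E : pred vertex) := forall u v, D u -> E v -> ~~ adj u v.

Lemma twist_weightU D E k : apart D E -> (forall v, D v -> ~~ E v) ->
  Tw (weight D k) * Tw (weight E k) = Tw (weight (predU D E) k).
Proof.
move=> DE disj; rewrite twistD.
  congr Tw; apply/funext => v; rewrite /weight /=; have := disj v.
  by case: (D v) (E v) => -[] //= h; rewrite ?add0r ?addr0 //; have := h isT.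
by move=> u v /weight_neq0 Du /weight_neq0 Ev; rewrite mem_nbrs DE.
Qed.

Lemma twist_weightD D k l : apart D D ->
  Tw (weight D k) * Tw (weight D l) = Tw (weight D (k + l)%R).
Proof.
move=> DD; rewrite twistD.
  congr Tw; apply/funext => v; rewrite /weight.
  by case: (D v); rewrite ?addr0 // mulrDr.
by move=> u v /weight_neq0 Du /weight_neq0 Ev; rewrite mem_nbrs DD.
Qed.

Definition layer (s : S) : pred vertex := fun v => v.1 == Some s.

Lemma layer_apart s : apart (layer s) (layer s).
Proof. by move=> u v /eqP us /eqP vs; rewrite /adj us vs eqxx. Qed.

Definition gen_act (l : S * bool) : selfmap (labelling vertex G) :=
  Tw (weight (layer l.1) (if l.2 then (-1)%R else 1%R)).

Section Pair.
Variables (s t : S) (n : nat).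
Hypotheses (st : s != t) (Mst : M s t = Some n.+1) (n_gt0 : 0 < n).

(** Over a pair s, t each block carries two chains: in one of them the
    vertices at even positions lie over s, in the other one those at odd
    positions. *)
Definition chain (b : bool) : pred vertex :=
  fun v => v.1 == Some (if odd (v.2 %% n) (+) b then t else s).

Definition strip b (I : pred nat) : pred vertex :=
  fun v => chain b v && I (v.2 %% n).

Lemma chain_block b c u v : chain b u -> chain c v -> u.1 != v.1 ->
  block u.1 v.1 = n.
Proof.
move=> /eqP -> /eqP ->.
by do 2 case: ifP => _; rewrite ?eqxx //= ?Mst // cox_sym Mst.
Qed.

(** Along an edge the position moves by one and the generator changes, so that
    the chain stays the same. *)
Lemma adj_chain b c u v : chain b u -> chain c v -> adj u v ->
  b = c /\ (v.2 = u.2.+1 /\ v.2 %% n = (u.2 %% n).+1 \/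
            u.2 = v.2.+1 /\ u.2 %% n = (v.2 %% n).+1).
Proof.
move=> ub vc /and3P[uv E]; rewrite (chain_block ub vc uv) => /eqP D.
have {E D} E : v.2 = u.2.+1 /\ v.2 %% n = (u.2 %% n).+1 \/
            u.2 = v.2.+1 /\ u.2 %% n = (v.2 %% n).+1.
  case/orP: E => /eqP E; [left | right]; split=> //; rewrite E in D *.
    exact: modS_same_div.
  by apply: modS_same_div; rewrite -D.
split=> //; move: uv; rewrite (eqP ub) (eqP vc).
by case: E => -[_ ->] /=; case: (odd _); case: b {ub}; case: c {vc};
  rewrite /= ?eqxx.
Qed.

Definition unlinked (I J : pred nat) :=
  forall i j, I i -> J j -> i <> j.+1 /\ j <> i.+1.

Lemma strip_apart b c I J : b != c \/ unlinked I J ->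
  apart (strip b I) (strip c J).
Proof.
move=> h u v /andP[ub uI] /andP[vc vJ]; apply/negP => /(adj_chain ub vc)[bc E].
case: h; rewrite ?bc ?eqxx // => /(_ _ _ uI vJ).
by case: E => -[_ ->]; lia.
Qed.

Definition chain_twist b I := Tw (weight (strip b I) 1%R).

Lemma chain_twist_ext b I J : (forall i, i < n -> I i = J i) ->
  chain_twist b I = chain_twist b J.
Proof.
move=> IJ; congr Tw; apply/funext => v.
by rewrite /weight /strip IJ // ltn_mod.
Qed.

Lemma chain_twist0 b : chain_twist b xpred0 = 1.
Proof.
rewrite -(twist0 nbrs G); congr Tw; apply/funext => v.
by rewrite /weight /strip andbF.
Qed.

Lemma chain_twistU b I J : far I J ->
  chain_twist b (predU I J) = chain_twist b I * chain_twist b J.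
Proof.
move=> IJ; rewrite twist_weightU.
- by congr Tw; apply/funext => v; rewrite /weight /strip /= andb_orr.
- by apply: strip_apart; right=> i j Ii Jj; have := IJ i j Ii Jj; lia.
move=> v /andP[_ vI]; apply/negP => /andP[_ vJ].
by have := IJ _ _ vI vJ; lia.
Qed.

(** A vertex at position i has exactly one neighbour at position j in its
    chain, the one in the same block. *)
Lemma chain_matched b i j : i < n -> j < n -> i = j.+1 \/ j = i.+1 ->
  matched nbrs (weight (strip b (pred1 i)) 1%R)
    (weight (strip b (pred1 j)) 1%R).
Proof.
move=> lin ljn ij u /weight_neq0 uD; have /andP[ub /eqP ui] := uD.
split; first by rewrite /weight uD mulr1 /sgn; case: odd; auto.
pose q := if i == j.+1 then u.2.-1 else u.2.+1.
pose w : vertex := (Some (if odd j (+) b then t else s), q).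
have [Eq qj qn] : [/\ q.+1 = u.2 \/ q = u.2.+1, q %% n = j & q %/ n = u.2 %/ n].
  rewrite /q; case: ij => ij.
    have u0 : 0 < u.2 by case: (u.2) ui => //; rewrite mod0n => /esym; lia.
    rewrite ij eqxx prednK //; have := prednK u0; move: (u.2.-1) => p Ep.
    rewrite -Ep in ui *; have D : p %/ n = p.+1 %/ n.
      by apply/div_modS/pred_mod => //; rewrite ui ij.
    rewrite -D; split=> //; first by left.
    by move: ui; rewrite modS_same_div // ij => -[].
  have -> : (i == j.+1) = false by lia.
  have D := @div_modS n u.2; rewrite ui -ij in D; rewrite -D //.
  by split; [right | rewrite modS_same_div ?ui // D |].
have wb : chain b w by rewrite /chain /= qj.
have uw : u.1 != w.1.
  rewrite (eqP ub) /= ui; case: ij => ->; rewrite /= ; 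
  by case: (odd _); case: b {ub uD wb w}; rewrite /= eqE /= // eq_sym.
exists w; split.
- rewrite mem_nbrs /adj uw (chain_block ub wb uw) /= qn eqxx andbT.
  by case: Eq => E; [rewrite -E | rewrite E]; rewrite eqxx ?orbT.
- rewrite /weight uD /strip wb /= qj eqxx /= !mulr1 /sgn.
  by case: Eq => E; [rewrite -E | rewrite E] => /=; case: odd; rewrite ?opprK.
move=> v; rewrite mem_nbrs => uv /weight_neq0/andP[vb /eqP vj].
have [_ E] := adj_chain ub vb uv.
have v2 : v.2 = q by rewrite /q; case: ifP; lia.
by rewrite [v]surjective_pairing (eqP vb) vj v2.
Qed.

Lemma chain_braid b i : i.+1 < n ->
  chain_twist b (pred1 i) * chain_twist b (pred1 i.+1) *
    chain_twist b (pred1 i) =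
  chain_twist b (pred1 i.+1) * chain_twist b (pred1 i) *
    chain_twist b (pred1 i.+1).
Proof.
move=> i1n; have in' := ltnW i1n.
have ind k : independent nbrs (weight (strip b (pred1 k)) 1%R).
  move=> u v /weight_neq0 uD /weight_neq0 vD; rewrite mem_nbrs.
  apply: (strip_apart (b := b) (c := b) _ uD vD).
  by right=> p q /= /eqP -> /eqP ->; lia.
apply: twist_braid => //.
- exact: nbrs_uniq.
- exact: nbrs_sym.
- by apply: chain_matched => //; right.
- by apply: chain_matched => //; left.
move=> u /weight_neq0/andP[_ /= /eqP ui].
rewrite /weight /strip /= ui; have -> : (i == i.+1) = false by lia.
by rewrite andbF.
Qed.

Lemma chain_exclusive v : chain false v -> ~~ chain true v.
Proof.
move=> /eqP Ev; rewrite /chain Ev.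
by case: odd; rewrite /= eqE /= // eq_sym.
Qed.

(** So each generator has one factor for either family of chains, and the
    families can be treated separately. *)
Lemma gen_act_row j :
  gen_act (if odd j then t else s, false) =
    chain_twist false (row 0 j) * chain_twist true (row 0 j.+1).
Proof.
rewrite twist_weightU; first 1 last.
- by apply: strip_apart; left.
- move=> v /andP[/chain_exclusive vc _]; apply: contra vc.
  by case/andP.
congr Tw; apply/funext => v; rewrite /weight /layer /strip /chain /row /=.
have ts : (Some t == Some s) = false by rewrite eqE /= eq_sym (negPf st).
have st' : (Some s == Some t) = false by rewrite eq_sym ts.
congr (if _ then _ else _).
by case: (odd j) (odd (v.2 %% n)) => -[] /=; rewrite ?andbT ?andbF ?orbF ?orbT.
Qed.

Lemma gen_act_row_swap j :
  gen_act (if odd j then s else t, false) =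
    chain_twist false (row 0 j.+1) * chain_twist true (row 0 j).
Proof.
have -> : (if odd j then s else t) = if odd j.+1 then t else s.
  by rewrite /=; case: odd.
rewrite gen_act_row; congr (_ * _); congr chain_twist.
by apply/funext => i; rewrite /row /= negbK.
Qed.

(** The two families of chains do not cross, so the relation splits into two
    instances of [dihedral_braid]. *)
Lemma gen_act_braid :
  \prod_(l <- pos_word (alt_prod s t n.+1)) gen_act l =
  \prod_(l <- pos_word (alt_prod t s n.+1)) gen_act l.
Proof.
have cW (I J : pred nat) :
    commute (chain_twist false I) (chain_twist true J).
  rewrite /commute !twist_weightU //.
  - by congr Tw; apply/funext => v; rewrite /weight /= orbC.
  - by apply: strip_apart; left.
  - move=> v /andP[vc _]; apply/negP => /andP[vf _].
    by have := chain_exclusive vf; rewrite vc.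
  - by apply: strip_apart; left.
  move=> v /andP[/chain_exclusive vc _]; apply: contra vc.
  by case/andP.
rewrite !alt_prodE /pos_word /mkseq -!map_comp !big_map.
rewrite (eq_bigr (fun j =>
    chain_twist false (row 0 j) * chain_twist true (row 0 j.+1)));
  last by move=> j _; rewrite /= gen_act_row.
rewrite [RHS](eq_bigr (fun j =>
    chain_twist false (row 0 j.+1) * chain_twist true (row 0 j)));
  last by move=> j _; rewrite /= gen_act_row_swap.
rewrite !prodgM_commute; [|by move=> *; exact: cW|by move=> *; exact: cW].
have dih b := @dihedral_braid _ n (chain_twist b) (@chain_twist_ext b)
  (chain_twist0 b) (@chain_twistU b) (@chain_braid b) 0 n (add0n n).
rewrite -[iota 0 n.+1]/(index_iota 0 n.+1) !big_mkord.
exact: (congr2 *%g (dih false) (esym (dih true))).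
Qed.
End Pair.
End Unfolding.

(** * Free reduction and substitutions *)

Lemma inv_word_cat (X : Type) (u v : gword X) :
  inv_word (u ++ v) = inv_word v ++ inv_word u.
Proof. by rewrite /inv_word map_cat rev_cat. Qed.

Lemma eval_word_inv (X : choiceType) (G : groupType) (f : X -> G)
    (w : gword X) :
  eval_word f (inv_word w) = (eval_word f w)^-1.
Proof.
elim: w => [|[x b] w IHw]; first by rewrite /eval_word !big_nil invg1.
rewrite -cat1s inv_word_cat !eval_word_cat IHw invgM; congr (_ * _).
by rewrite /eval_word !big_seq1; case: b => //=; rewrite invgK.
Qed.

Section FreeReduction.
Variable X : choiceType.
Implicit Types (l : X * bool) (u v w z : gword X).

Definition opp l : X * bool := (l.1, ~~ l.2).

Lemma oppK : involutive opp.
Proof. by case=> x b; rewrite /opp /= negbK. Qed.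

Definition no_rel : relations X := fun _ _ => False.

Definition reduced w : bool := sorted (fun k l => l != opp k) w.

Definition push l w : gword X :=
  if w is k :: w' then if k == opp l then w' else l :: w else [:: l].

Definition red w : gword X := foldr push [::] w.

Lemma reduced_push l w : reduced w -> reduced (push l w).
Proof.
case: w => //= k w kw; case: (eqVneq k (opp l)) => [_ | kl] /=.
  exact: path_sorted kw.
by rewrite kl.
Qed.

Lemma reduced_foldr u z : reduced z -> reduced (foldr push z u).
Proof. by move=> rz; elim: u => //= l u; exact: reduced_push. Qed.

Lemma reduced_red u : reduced (red u).
Proof. exact: reduced_foldr. Qed.

Lemma red_id u : reduced u -> red u = u.
Proof.
elim: u => // l [|k u] IHu // lku.
have := IHu (path_sorted lku); rewrite /red /= => ->.
by move: lku => /= /andP[/negPf-> _].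
Qed.

Lemma pushK l z : reduced z -> push l (push (opp l) z) = z.
Proof.
case: z => [_|k z kz] /=; first by rewrite eqxx.
rewrite oppK; case: (eqVneq k l) => [kl | _] /=; last by rewrite eqxx.
rewrite kl in kz *; case: z kz => //= j z /andP[/negPf-> //].
Qed.

(** Pushing letters onto reduced words is an action of the free group; this
    makes reduced words a normal form. *)
Lemma foldr_push_eq R u v : (forall a b, ~ R a b) -> pres_eq R u v ->
  forall z, reduced z -> foldr push z u = foldr push z v.
Proof.
move=> R0; elim=> {u v} [//|u v _ IH|u v w _ IH1 _ IH2
  |u u' v v' _ IHu _ IHv|x b|u v /R0 //] z rz.
- by rewrite IH.
- by rewrite IH1 ?IH2.
- rewrite !foldr_cat IHv // IHu //.
  exact: reduced_foldr.
- exact: (pushK (x, b)).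
Qed.

Lemma red_eq u v : pres_eq no_rel u v -> red u = red v.
Proof. by move=> uv; exact: (foldr_push_eq (fun _ _ => id) uv). Qed.

Lemma pres_eq_push (R : relations X) l z : pres_eq R (l :: z) (push l z).
Proof.
case: z => [|k z] /=; first exact: pres_eq_refl.
case: eqVneq => [-> | _]; last exact: pres_eq_refl.
rewrite -[_ :: _]/([:: l; opp l] ++ z) -[X in pres_eq _ _ X]/([::] ++ z).
by apply: pres_eq_cat (pres_eq_refl _ _); case: l => x b; exact: pres_eq_cancel.
Qed.

Lemma pres_eq_red (R : relations X) u : pres_eq R u (red u).
Proof.
elim: u => [|l u IHu]; first exact: pres_eq_refl.
apply: pres_eq_trans (pres_eq_push _ _ _).
by apply: (pres_eq_cat (u := [:: l]) (u' := [:: l])) => //; exact: pres_eq_refl.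
Qed.

Lemma red_cat u v : red (u ++ v) = foldr push (red v) u.
Proof. exact: foldr_cat. Qed.

Lemma eval_word_red (G : groupType) (f : X -> G) u :
  eval_word f (red u) = eval_word f u.
Proof.
by apply/esym/(@eval_word_pres_eq _ no_rel) => //; exact: pres_eq_red.
Qed.

Lemma red_conj c w : red (inv_word c ++ w ++ c) = [::] -> red w = [::].
Proof.
move=> E; have Ew : pres_eq no_rel (inv_word c ++ w ++ c) [::].
  by rewrite -E; exact: pres_eq_red.
apply: (red_eq (v := [::])); apply: pres_eq_trans (pres_eq_invr _ c).
have cw : pres_eq no_rel ((c ++ inv_word c) ++ w ++ (c ++ inv_word c)) w.
  rewrite -[X in pres_eq _ _ X]cats0.
  apply: (pres_eq_cat (u' := [::]) (pres_eq_invr _ c)).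
  exact: pres_eq_cat (pres_eq_refl _ _) (pres_eq_invr _ c).
apply: pres_eq_trans (pres_eq_sym cw) _.
have -> : (c ++ inv_word c) ++ w ++ (c ++ inv_word c) =
    c ++ (inv_word c ++ w ++ c) ++ inv_word c by rewrite !catA.
apply: pres_eq_cat (pres_eq_refl _ _) _.
by apply: (pres_eq_cat (u' := [::]) Ew); exact: pres_eq_refl.
Qed.

End FreeReduction.

Section Substitution.
Variables (X : choiceType) (W : pred X) (c : X -> gword X).
Implicit Types (y : X * bool) (u v w r : gword X).
Notation allW := (all (fun l : X * bool => W l.1)).
Hypothesis c_W : forall p, allW (c p).
Hypothesis c_id : forall p, W p -> c p = [::].

Definition pre y := if y.2 then [::] else c y.1.
Definition suf y := if y.2 then inv_word (c y.1) else [::].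
(** The letters of W generate a subgroup that is fixed, and every other
    generator p is multiplied on the left by an element c p of this subgroup. *)
Definition subst w : gword X := flatten [seq pre y ++ y :: suf y | y <- w].

Lemma subst_cat u v : subst (u ++ v) = subst u ++ subst v.
Proof. by rewrite /subst map_cat flatten_cat. Qed.

Lemma allW_inv w : allW (inv_word w) = allW w.
Proof. by rewrite all_rev all_map; exact: eq_all. Qed.

Lemma allW_pre y : allW (pre y).
Proof. by rewrite /pre; case: y.2. Qed.

Lemma allW_suf y : allW (suf y).
Proof. by rewrite /suf; case: y.2; rewrite ?allW_inv. Qed.

Lemma subst_W w : allW w -> subst w = w.
Proof.
elim: w => //= l w IHw /andP[Wl /IHw Ew]; rewrite /subst /= -/(subst w) Ew.
by rewrite /pre /suf c_id //; case: l.2.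
Qed.

Lemma allW_red u : allW u -> allW (red u).
Proof.
elim: u => //= l u IHu /andP[Wl /IHu]; rewrite -/(red u).
by case: (red u) => [|k w] /= => [_ | /andP[Wk Ww]]; [|case: ifP => _ //=];
  rewrite ?Wl ?Wk.
Qed.

Lemma red_blockl u z : allW u -> (if z is k :: _ then ~~ W k.1 else true) ->
  foldr (@push X) z u = red u ++ z.
Proof.
move=> + hz; elim: u => //= l u IHu /andP[Wl Wu]; rewrite IHu // -/(red u).
case: (red u) => [|k w] /=; last by case: ifP.
case: z hz {IHu} => //= k z Wk; case: eqVneq => // E.
by move: Wk; rewrite E /= Wl.
Qed.

Lemma W_split w : allW w \/ exists u y r,
  [/\ w = u ++ y :: r, allW u & ~~ W y.1].
Proof.
elim: w => [|l w IHw]; first by left.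
case: (boolP (W l.1)) => Wl; last by right; exists [::], l, w.
case: IHw => [Ww | [u [y [r [-> Wu Wy]]]]]; first by left; rewrite /= Wl.
by right; exists (l :: u), y, r; rewrite /= Wl.
Qed.

Lemma reduced_catr u v : reduced (u ++ v) -> reduced v.
Proof. by elim: u => //= l u IHu h; apply: IHu; exact: path_sorted h. Qed.

(** The letters outside W all survive. If two consecutive ones are inverse to
    each other, then they enclose a nontrivial word over W, which the
    substitution either preserves or conjugates by some c p [red_conj]; it
    stays nontrivial and keeps them apart. *)
Lemma red_subst u y r : allW u -> ~~ W y.1 -> reduced (y :: r) ->
  red (u ++ subst (y :: r)) = red (u ++ pre y) ++ y :: red (suf y ++ subst r).
Proof.
have [n] := ubnP (size r); elim: n u y r => // n IHn u y r rn Wu Wy yr.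
rewrite /subst /= -/(subst r) -catA [_ ++ _ ++ _]catA cat_cons red_cat.
have -> : red (y :: suf y ++ subst r) = y :: red (suf y ++ subst r).
  rewrite /red /= -/(red _).
  suff : ohead (red (suf y ++ subst r)) <> Some (opp y).
    case: (red (suf y ++ subst r)) => //= k z ky; case: eqVneq => // E.
    by case: ky; rewrite E.
  have Wh v z : allW v -> ohead (v ++ z) = Some (opp y) -> v = [::].
    by case: v => //= k v /andP[Wk _] [Ek]; move: Wk; rewrite Ek (negPf Wy).
  case: (W_split r) => [Wr | [w [y' [r' [Er Ww Wy']]]]].
    rewrite subst_W // => h.
    have Ws : allW (red (suf y ++ r)) by rewrite allW_red // all_cat allW_suf.
    by move: h; rewrite -[red _]cats0 => h; move: (h); rewrite (Wh _ _ Ws h).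
  rewrite Er subst_cat subst_W // catA IHn //; first last.
  - by move: yr; rewrite Er -cat_cons => /reduced_catr.
  - by rewrite all_cat allW_suf.
  - by move: rn; rewrite Er size_cat /= => rn; lia.
  move=> h; have E0 : red ((suf y ++ w) ++ pre y') = [::].
    by apply: Wh h; rewrite allW_red // !all_cat allW_suf Ww allW_pre.
  move: h; rewrite E0 /= => -[y'y].
  have w0 : w = [::].
    have rw : reduced w.
      move: yr; rewrite Er /reduced -cat1s => /reduced_catr.
      by rewrite /reduced => /cat_sorted2[].
    rewrite -(red_id rw); move: E0.
    rewrite y'y /suf /pre /=; case: y.2; rewrite /= ?cats0 //.
    by rewrite -catA; exact: red_conj.
  by move: yr; rewrite Er w0 y'y /= eqxx.
by rewrite red_blockl // all_cat Wu allW_pre.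
Qed.

(** Between two adjacent letters outside W, the image contains exactly what
    the substitution inserts there. *)
Lemma subst_pair y1 y2 L R u : ~~ W y1.1 -> ~~ W y2.1 -> allW u ->
  reduced (L ++ y1 :: y2 :: R) ->
  exists A B, red (u ++ subst (L ++ y1 :: y2 :: R)) =
    A ++ (y1 :: red (suf y1 ++ pre y2) ++ [:: y2]) ++ B.
Proof.
move=> W1 W2; elim: L u => [|l L IHL] u Wu r12.
  rewrite red_subst // red_subst ?allW_suf //; last by case/andP: r12.
  exists (red (u ++ pre y1)), (red (suf y2 ++ subst R)).
  by rewrite cat_cons -catA.
have rL : reduced (L ++ y1 :: y2 :: R) by exact: path_sorted r12.
case: (boolP (W l.1)) => Wl.
  have [] := IHL (rcons u l) _ rL; first by rewrite all_rcons Wl.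
  move=> A [B E]; exists A, B; rewrite -E cat_cons.
  rewrite -[l :: L ++ _]/([:: l] ++ (L ++ _)) subst_cat subst_W;
    last by rewrite /= Wl.
  by rewrite -cats1 -catA.
rewrite cat_cons red_subst //; have [A [B ->]] := IHL _ (allW_suf l) rL.
by exists (red (u ++ pre l) ++ l :: A), B; rewrite -catA.
Qed.

End Substitution.

(** * Twists acting on reduced words *)

(** For b = true this is the inverse of the positive word on l. *)
Definition sign_word (X : Type) (b : bool) (l : seq X) : gword X :=
  [seq (x, b) | x <- if b then rev l else l].

Lemma inv_sign_word (X : Type) b (l : seq X) :
  inv_word (sign_word b l) = sign_word (~~ b) l.
Proof.
rewrite /inv_word /sign_word -!map_comp; case: b => /=.
  by rewrite -map_rev revK.
by rewrite -map_rev.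
Qed.

Lemma reduced_sign_word (X : choiceType) b (l : seq X) :
  reduced (sign_word b l).
Proof.
rewrite /sign_word; move: (if b then rev l else l) => {}l.
elim: l => //= x [|y l] //= ->; rewrite andbT.
by apply/eqP => -[_]; case: b.
Qed.

Lemma sign_word_cat (X : Type) b (l1 l2 : seq X) :
  sign_word b (l1 ++ l2) =
    if b then sign_word b l2 ++ sign_word b l1
    else sign_word b l1 ++ sign_word b l2.
Proof. by rewrite /sign_word; case: b; rewrite ?rev_cat map_cat. Qed.

Lemma sign_word_infix (X : Type) b (l1 l l2 : seq X) :
  exists A B, sign_word b (l1 ++ l ++ l2) = A ++ sign_word b l ++ B.
Proof.
rewrite !sign_word_cat; case: b.
  by exists (sign_word true l2), (sign_word true l1); rewrite -catA.
by exists (sign_word false l1), (sign_word false l2).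
Qed.

Definition word_expz (X : Type) (l : seq X) (k : int) : gword X :=
  sign_word (if k is Negz _ then true else false) (flatten (nseq `|k|%N l)).

Lemma eval_word_expz (X : choiceType) (G : groupType) (x : X -> G) l k :
  eval_word x (word_expz l k) = expgz (\prod_(a <- l) x a) k.
Proof.
have pos n : eval_word x (sign_word false (flatten (nseq n l))) =
    (\prod_(a <- l) x a) ^+ n.
  rewrite /eval_word /sign_word big_map /=.
  elim: n => [|n IHn]; first by rewrite big_nil.
  by rewrite /= big_cat IHn expgS.
case: k => n; rewrite /word_expz; first exact: pos.
by rewrite -[true]/(~~ false) -inv_sign_word eval_word_inv pos.
Qed.

(** The copy of w in the second repetition of l has a predecessor. This is
    the place where the exponents have to be at least 2. *)
Lemma flatten_nseq_pair (T : eqType) (l : seq T) w n : w \in l -> 2 <= n ->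
  exists z A B, flatten (nseq n l) = A ++ [:: z; w] ++ B.
Proof.
case: n => [|[|n]] // wl _ /=; move: (flatten _) => r.
case/splitPr: wl => l1 l2.
case/lastP E: ((l1 ++ w :: l2) ++ l1) => [|l' z]; first by case: l1 E.
exists z, l', (l2 ++ r); rewrite -cats1 in E.
transitivity (((l1 ++ w :: l2) ++ l1) ++ (w :: l2) ++ r).
  by rewrite -!catA.
by rewrite E -!catA.
Qed.

Section Words.
Variables (V : choiceType) (N : V -> seq V).
Implicit Types (e : V -> int) (p : V * V) (w g : gword (V * V)).

(** The word that a twist inserts at the start of the arc p. *)
Definition twist_word e p : gword (V * V) :=
  if p.1 \in N p.2 then word_expz [seq (p.2, v) | v <- cyc N p.2 p.1] (e p.2)
  else [::].

Lemma eval_word_twist (G : groupType) e (x : V * V -> G) w :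
  eval_word x (subst (twist_word e) w) = eval_word (twist N e x) w.
Proof.
elim: w => [|[p b] w IHw]; first by rewrite /eval_word !big_nil.
rewrite -cat1s subst_cat eval_word_cat [in RHS]eval_word_cat IHw; congr (_ * _).
have pE : eval_word x (twist_word e p) * x p = twist N e x p.
  rewrite /twist_word /twist; case: ifP => _.
    by rewrite eval_word_expz big_map.
  by rewrite /eval_word big_nil.
have oneE (f : V * V -> G) l :
    eval_word f [:: l] = if l.2 then (f l.1)^-1 else f l.1.
  by rewrite /eval_word big_seq1.
rewrite oneE /subst /pre /suf; case: b => /=; rewrite cats0.
  by rewrite -cat1s eval_word_cat eval_word_inv oneE /= -invgM pE.
by rewrite eval_word_cat oneE.
Qed.

Definition twist_path w e : gword (V * V) := red (subst (twist_word e) w).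

(** Composition is reversed between labellings and paths: the leftmost twist
    is the first one to act on the path. *)
Lemma eval_word_twist_paths (G : groupType) es (x : labelling V G) w :
  eval_word ((\prod_(e <- es) (twist N e : selfmap (labelling V G))) x) w =
    eval_word x (foldl twist_path w es).
Proof.
elim: es w => [|e es IHes] w; first by rewrite big_nil.
by rewrite big_cons /= -IHes eval_word_red eval_word_twist.
Qed.

Lemma reduced_twist_paths es w : reduced w -> reduced (foldl twist_path w es).
Proof. by elim: es w => //= e es IHes w _; apply/IHes/reduced_red. Qed.

(** The path g runs along v straight through the crossing with u, where the
    arc (v, u) starts; b = true means that it does so against the orientation
    of v. *)
Definition passes v u g := exists b z A B,
  g = A ++ sign_word b [:: (v, z); (v, u)] ++ B.

Section Step.
Variable e : V -> int.
Hypothesis e_ind : independent N e.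

Let W (p : V * V) := e p.1 != 0%R.

Lemma twist_word0 p : e p.2 = 0%R -> twist_word e p = [::].
Proof. by move=> ep; rewrite /twist_word ep if_same. Qed.

Lemma twist_word_W p : all (fun l => W l.1) (twist_word e p).
Proof.
case: (eqVneq (e p.2) 0%R) => [/twist_word0 -> // | ep].
rewrite /twist_word; case: ifP => // _; apply/allP => l /mapP[a al ->] /=.
have : a \in flatten (nseq `|e p.2|%N [seq (p.2, v) | v <- cyc N p.2 p.1]).
  by move: al; case: (e p.2) => n //; rewrite mem_rev.
by case/flattenP => s /nseqP[-> _] /mapP[v _ ->].
Qed.

Lemma twist_word_id p : W p -> twist_word e p = [::].
Proof.
move=> Wp; rewrite /twist_word; case: ifP => // pN.
have [-> // | ep] := eqVneq (e p.2) 0%R.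
by have := e_ind ep Wp; rewrite pN.
Qed.

Lemma twist_path_pair b a1 a2 A B : ~~ W a1 -> ~~ W a2 ->
  reduced (A ++ sign_word b [:: a1; a2] ++ B) ->
  exists A' B', twist_path (A ++ sign_word b [:: a1; a2] ++ B) e = A' ++
   (if b then [:: (a2, true)] ++ inv_word (twist_word e a2) ++ [:: (a1, true)]
         else [:: (a1, false)] ++ twist_word e a2 ++ [:: (a2, false)]) ++ B'.
Proof.
move=> W1 W2; have rt p :
    reduced (twist_word e p) /\ reduced (inv_word (twist_word e p)).
  rewrite /twist_word; case: ifP => // _.
  by rewrite /word_expz inv_sign_word !reduced_sign_word.
case: b => r.
  have [] := subst_pair (W := W) twist_word_W twist_word_id
     (y1 := (a2, true)) (y2 := (a1, true)) (u := [::]) W2 W1 isT r.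
  rewrite /suf /pre /= cats0 [red (inv_word _)]red_id; last by case: (rt a2).
  by move=> A' [B' E]; exists A', B'.
have [] := subst_pair (W := W) twist_word_W twist_word_id
     (y1 := (a1, false)) (y2 := (a2, false)) (u := [::]) W1 W2 isT r.
rewrite /suf /pre /= [red (twist_word _ _)]red_id; last by case: (rt a2).
by move=> A' [B' E]; exists A', B'.
Qed.

(** Neither v nor u is twisted, so nothing is inserted between the two arcs. *)
Lemma passes_persist v u g : e v = 0%R -> e u = 0%R -> reduced g ->
  passes v u g -> passes v u (twist_path g e).
Proof.
move=> ev eu r [b [z [A [B E]]]]; rewrite E in r *.
have [] := @twist_path_pair b _ _ A B _ _ r; rewrite /W /= ?ev ?eqxx //.
move=> A' [B' ->]; rewrite twist_word0 // /passes.
by exists b, z, A', B'; case: (b).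
Qed.

(** Between the two arcs of v the loop around u is inserted e u times, and
    its square already runs through every crossing on u. *)
Lemma passes_create v u (w : V) g : e v = 0%R -> 2 <= `|e u|%N ->
  v \in N u -> w \in N u -> reduced g ->
  passes v u g -> passes u w (twist_path g e).
Proof.
move=> ev eu vN wN r [b [z [A [B E]]]]; rewrite E in r *.
have [] := @twist_path_pair b _ _ A B _ _ r; rewrite /W /= ?ev ?eqxx //.
move=> A' [B' ->].
have [c [y [A1 [B1 E1]]]] : exists c y A1 B1,
    twist_word e (v, u) = A1 ++ sign_word c [:: (u, y); (u, w)] ++ B1.
  rewrite /twist_word /= vN /word_expz.
  have -> k l : nseq k [seq (u, v) | v <- l] = map (map (pair u)) (nseq k l).
    by rewrite map_nseq.
  rewrite -map_flatten.
  have [|y [l1 [l2 ->]]] := flatten_nseq_pair (w := w) _ eu (l := cyc N u v).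
    by rewrite mem_cyc.
  rewrite !map_cat; set c := (X in sign_word X _).
  have [A1 [B1 ->]] := sign_word_infix c (map (pair u) l1)
    (map (pair u) [:: y; w]) (map (pair u) l2).
  by exists c, y, A1, B1.
rewrite E1 /passes; case: (b).
  exists (~~ c), y, (A' ++ (v, u, true) :: inv_word B1),
    (inv_word A1 ++ (v, z, true) :: B').
  by rewrite !inv_word_cat inv_sign_word -!catA /= -!catA.
exists c, y, (A' ++ (v, z, false) :: A1), (B1 ++ (v, u, false) :: B').
by rewrite -!catA /= -!catA.
Qed.

End Step.
End Words.

(** * Syllables *)

Section Syllables.
Variables (S : finType) (M : coxeter_matrix S).

Definition commuting (s t : S) : bool := M s t == Some 2.

Lemma commutingC s t : commuting s t = commuting t s.
Proof. by rewrite /commuting cox_sym. Qed.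

Lemma commutingss s : commuting s s = false.
Proof. by rewrite /commuting cox_diag. Qed.

Definition syl_prod (G : groupType) (f : S -> G) (ws : seq (S * int)) : G :=
  \prod_(p <- ws) expgz (f p.1) p.2.

(** A consequence of being reduced. It only tests the syllables met when one
    always moves on to the first syllable that does not commute with the
    present one; these are the syllables that carry a path along. *)
Fixpoint greedy_reduced (s : S) (ws : seq (S * int)) : bool :=
  if ws is (r, k) :: ws' then
    if commuting s r then greedy_reduced s ws'
    else (r != s) && greedy_reduced r ws'
  else true.

Lemma syl_prod_cons (G : groupType) (f : S -> G) s k ws :
  syl_prod f ((s, k) :: ws) = expgz (f s) k * syl_prod f ws.
Proof. by rewrite /syl_prod big_cons. Qed.

(** If the condition fails, some syllable meets a later one of the same
    generator across syllables that commute with it, and the two can be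
    merged. *)
Lemma syl_prod_shorten (G : groupType) (f : S -> G) :
  (forall s t, commuting s t -> commute (f s) (f t)) ->
  forall s k ws, ~~ greedy_reduced s ws ->
  exists ws', size ws' <= size ws /\ syl_prod f ws' = syl_prod f ((s, k) :: ws).
Proof.
move=> fC s k ws; elim: ws s k => // -[r l] ws IHws s k /=.
case: ifP => sr ng.
  have [ws' [le E]] := IHws s k ng; exists ((r, l) :: ws'); split=> //.
  rewrite !syl_prod_cons in E *; rewrite E !mulgA; congr (_ * _).
  by apply: commute_expgz; apply: fC; rewrite commutingC.
have [rs | rs] := eqVneq r s.
  exists ((s, (k + l)%R) :: ws); split=> //.
  by rewrite rs !syl_prod_cons expgzD mulgA.
rewrite rs /= in ng.
have [ws' [le E]] := IHws r l ng; exists ((s, k) :: ws'); split=> //.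
by rewrite !syl_prod_cons in E *; rewrite E.
Qed.

Lemma syl_prod_normal (G : groupType) (f : S -> G) :
  (forall s t, commuting s t -> commute (f s) (f t)) ->
  forall ws, exists ws',
  [/\ syl_prod f ws' = syl_prod f ws, all (fun p => p.2 != 0%R) ws' &
      if ws' is (s, _) :: ws'' then greedy_reduced s ws'' else true].
Proof.
move=> fC ws; have [n] := ubnP (size ws); elim: n ws => // n IHn ws lt_ws.
have [nz | ] := boolP (all (fun p => p.2 != 0%R) ws); last first.
  case/allPn => -[s k] + /=; rewrite negbK => + /eqP k0.
  rewrite {}k0 => sk; case/splitPr: sk lt_ws => w1 w2 lt_ws.
  have [|ws' [E nz g]] := IHn (w1 ++ w2).
    by move: lt_ws; rewrite !size_cat /=; lia.
  exists ws'; split=> //; rewrite E /syl_prod !big_cat big_cons expgz0 /=.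
  by rewrite mul1g.
case: ws nz lt_ws => [|[s k] ws] nz lt_ws; first by exists [::].
have [gd | ng] := boolP (greedy_reduced s ws); first by exists ((s, k) :: ws).
have [ws1 [le E1]] := syl_prod_shorten fC k ng.
have [|ws' [E nz' g]] := IHn ws1; first exact: leq_ltn_trans le lt_ws.
by exists ws'; rewrite E E1.
Qed.

End Syllables.

Section Unfolded.
Variables (S : finType) (M : coxeter_matrix S).
Notation vertex := (vertex S).
Notation nbrs := (@nbrs S M).

Lemma nbr_index n i : 1 < n ->
  exists j, (j = i.+1 \/ i = j.+1) /\ i %/ n = j %/ n.
Proof.
move=> n1; have [/div_modS E | le] := ltnP (i %% n).+1 n.
  by exists i.+1; split; [left | apply: E; lia].
case: i le => [|p]; first by rewrite mod0n; lia.
move=> le; exists p; split; first by right.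
by apply/esym/div_modS/pred_mod; lia.
Qed.

Lemma exists_nbr x y i : x != y -> 1 < block M x y ->
  exists j, (y, j) \in nbrs (x, i).
Proof.
move=> xy /(nbr_index i)[j [ij E]]; exists j.
rewrite mem_nbrs /adj /= xy E eqxx.
by case: ij => ->; rewrite eqxx ?orbT.
Qed.

Lemma block_noncomm s t :
  s != t -> ~~ commuting M s t -> 1 < block M (Some s) (Some t).
Proof.
move=> st; rewrite /commuting /=; case E: (M s t) => [k|] // k2.
by have := cox_offdiag st E; case: k E k2 => [|[|[|k]]].
Qed.

Definition passes_all v (g : gword (vertex * vertex)) :=
  forall u, u \in nbrs v -> passes v u g.

Lemma weight_layer_ind (s : S) K : independent nbrs (weight (layer s) K).
Proof.
move=> u v /weight_neq0 us /weight_neq0 vs; rewrite mem_nbrs.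
exact: layer_apart us vs.
Qed.

Lemma absz_weight (s : S) K i : `|weight (layer s) K (Some s, i)|%N = `|K|%N.
Proof.
by rewrite /weight /layer eqxx abszM /sgn /=; case: odd; rewrite mul1n.
Qed.

(** Follow the syllables given by [greedy_reduced]: those that commute with
    the current generator s twist along circles that do not cross the one
    considered, and the next one that does not commute carries the property
    over to an adjacent circle. *)
Lemma winding_survives (ws : seq (S * int)) s i (g : gword (vertex * vertex)) :
  greedy_reduced M s ws -> all (fun p => 2 <= `|p.2|%N) ws -> reduced g ->
  passes_all (Some s, i) g ->
  exists2 l,
    l \in foldl (twist_path nbrs) g [seq weight (layer p.1) p.2 | p <- ws]
     & l.1.1.1 != None.
Proof.
elim: ws s i g => [|[r K] ws IHws] s i g /=.
  move=> _ _ _ cr; have [j] : exists j, (None, j) \in nbrs (Some s, i).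
    exact: exists_nbr.
  case/cr => b [z [A [B ->]]].
  exists ((Some s, i), z, b) => //; rewrite !mem_cat.
  by case: b; rewrite !inE eqxx ?orbT.
move=> gd /andP[K2 Kws] rg cr.
have rg' : reduced (twist_path nbrs g (weight (layer r) K)).
  exact: reduced_red.
have ind := @weight_layer_ind r K.
have w0 (v : vertex) : v.1 != Some r -> weight (layer r) K v = 0%R.
  by rewrite /weight /layer => /negPf->.
have [sr | sr] := boolP (commuting M s r).
  rewrite sr in gd; apply: (IHws s i) => // u us.
  apply: passes_persist => //.
  - rewrite w0 //=; apply: contraL sr => /eqP[->]; by rewrite commutingss.
  - rewrite w0 //; apply: contraTneq us => ur.
    rewrite mem_nbrs /adj ur /= (eqP sr) /= !divn1.
    by apply/negP => /and3P[_ /orP[]/eqP-> /eqP]; lia.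
  - exact: cr.
rewrite (negPf sr) in gd; case/andP: gd => rs gd.
rewrite eq_sym in rs.
have [j jN] : exists j, (Some r, j) \in nbrs (Some s, i).
  by apply: exists_nbr; rewrite ?block_noncomm // eqE.
apply: (IHws r j) => // u ur.
apply: (@passes_create _ nbrs _ ind (Some s, i)) => //.
- by rewrite w0 // eqE.
- by rewrite absz_weight.
- by rewrite nbrs_sym.
- exact: cr.
Qed.

End Unfolded.

(** * Powers of Artin generators *)

Section Action.
Variables (S : finType) (M : coxeter_matrix S) (G : groupType).
Notation maps := (selfmap (labelling (vertex S) G)).
Notation Tw := (@twist (vertex S) (@nbrs S M) G).

Definition word_act (w : gword S) : maps := \prod_(l <- w) @gen_act S M G l.

Lemma word_act_eq u v : pres_eq (artin_rel M) u v -> word_act u = word_act v.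
Proof.
apply: pres_eq_prod => {u v} [s b | u v [s [t [k [Mst -> ->]]]]].
  rewrite /gen_act twist_weightD; last exact: layer_apart.
  rewrite -(twist0 (@nbrs S M) G); congr Tw; apply/funext => v.
  by rewrite /weight; case: b; rewrite ?addNr ?subrr ?mulr0 if_same.
have [<- // | st] := eqVneq s t.
have k2 := cox_offdiag st Mst; have Ek : k = k.-1.+1 by lia.
by rewrite Ek in Mst *; apply: gen_act_braid => //; lia.
Qed.

Definition act (g : artin_group M) : maps := word_act (repr g).

Lemma act_class w : act (pres_class (artin_rel M) w) = word_act w.
Proof. by apply/word_act_eq/pres_eq_repr. Qed.

Lemma act1 : act 1 = 1.
Proof. by rewrite [1]/(pres_class _ [::]) act_class /word_act big_nil. Qed.

Lemma actM g h : act (g * h) = act g * act h.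
Proof.
by rewrite [g * h]/(pres_class _ _) act_class /word_act big_cat.
Qed.

Lemma act_expgz s k :
  act (expgz (artin_gen M s) k) = Tw (weight (layer s) k).
Proof.
have one b : word_act [:: (s, b)] =
    Tw (weight (layer s) (if b then (-1)%R else 1%R)).
  by rewrite /word_act big_seq1.
have gV : (artin_gen M s)^-1 = pres_class (artin_rel M) [:: (s, true)].
  apply: mulg1_eq; rewrite -[_ * _]pres_class_cat.
  by apply/pres_classP; exact: pres_eq_cancel.
have pow (g : artin_group M) (d : int) n : act g = Tw (weight (layer s) d) ->
    act (g ^+ n) = Tw (weight (layer s) (d *+ n)%R).
  move=> Eg; elim: n => [|n IHn].
    rewrite act1 -(twist0 (@nbrs S M) G); congr Tw; apply/funext => v.
    by rewrite /weight mulr0n mulr0 if_same.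
  rewrite expgS actM Eg IHn twist_weightD ?mulrS //; exact: layer_apart.
case: k => n.
  by rewrite (pow _ 1%R) ?natz // act_class one.
have -> : expgz (artin_gen M s) (Negz n) = (artin_gen M s)^-1 ^+ n.+1.
  by rewrite expVgn.
rewrite (pow _ (-1)%R); last by rewrite gV act_class one.
by rewrite NegzE mulNrn natz.
Qed.

Lemma act_prod ws : act (syl_prod (artin_gen M) ws) =
  \prod_(p <- ws) (Tw (weight (layer p.1) p.2) : maps).
Proof.
elim: ws => [|[s k] ws IHws]; first by rewrite /syl_prod !big_nil act1.
by rewrite syl_prod_cons big_cons actM act_expgz IHws.
Qed.
End Action.

(** Label the arcs by free generators, so that an element acting trivially
    fixes every reduced path. The path g goes twice through an arc of the
    cone circle (None, 1) and contains no arc over a generator, contrary to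
    what [winding_survives] says about its image. *)
Lemma syl_prod_artin_neq1 (S : finType) (M : coxeter_matrix S) s k ws :
  greedy_reduced M s ws -> all (fun p => 2 <= `|p.2|%N) ((s, k) :: ws) ->
  syl_prod (artin_gen M) ((s, k) :: ws) <> 1.
Proof.
move=> gd /= /andP[k2 kws] E.
pose V := vertex S; pose X : choiceType := (V * V)%type.
pose F := presented (@no_rel X).
pose x : labelling V F := @pres_gen X (@no_rel X).
(* The numbers 0 and 1 form the first block of length 2. *)
pose v : V := (None, 1%N); pose u : V := (Some s, 0).
pose g : gword X := [:: (v, u, false); (v, u, false)].
pose es := [seq weight (layer p.1) p.2 | p <- (s, k) :: ws].
have vu : u \in nbrs M v by rewrite mem_nbrs.
have rg : reduced g by exact: (reduced_sign_word false [:: (v, u); (v, u)]).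
have fixed : foldl (twist_path (nbrs M)) g es = g.
  have P1 :
      (\prod_(e <- es) (twist (nbrs M) e : selfmap (labelling V F))) x = x.
    by rewrite big_map -act_prod E act1.
  have := eval_word_twist_paths (nbrs M) es x g; rewrite P1 -!pres_class_eval.
  by move/pres_classP/red_eq; rewrite (red_id rg) red_id ?reduced_twist_paths.
have [||l] := @winding_survives S M ws s 0
  (twist_path (nbrs M) g (weight (layer s) k)) gd kws.
- exact: reduced_red.
- move=> w uw; apply: (@passes_create _ (nbrs M) _ _ v) => //.
  + exact: weight_layer_ind.
  + by rewrite absz_weight.
  + by rewrite nbrs_sym.
  by exists false, u, [::], [::].
rewrite -[foldl _ _ _]/(foldl (twist_path (nbrs M)) g es) fixed.
by rewrite !inE => /orP[] /eqP ->.
Qed.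

Theorem theorem1 (S : finType) (M : coxeter_matrix S) (m : S -> nat)
    (hm : forall s, (2 <= m s)%N) :
  exists phi : {multiplicative commutation_group M -> artin_group M},
    (forall s, phi (commutation_gen M s) = artin_gen M s ^+ m s) /\
    injective phi.
Proof.
have eval2 (G : groupType) (f : S -> G) a b :
    eval_word f (pos_word [:: a; b]) = f a * f b.
  by rewrite /eval_word !big_cons big_nil mulg1.
have commuting_artin s t :
    commuting M s t -> commute (artin_gen M s) (artin_gen M t).
  move=> /eqP Mst; rewrite /commute -[LHS]pres_class_cat -[RHS]pres_class_cat.
  by apply/pres_classP/pres_eq_rel; exists s, t, 2.
have [u v [s [t [Mst -> ->]]]|phi phi_gen] := @pres_lift S (commutation_rel M)
    (artin_group M) (fun s => artin_gen M s ^+ m s).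
  rewrite !eval2; apply/commuteX2/commuting_artin.
  by rewrite /commuting Mst.
exists phi; split=> //.
have phi1 : phi 1 = 1 by apply/(mulgI (phi 1)); rewrite -gmulfM !mulg1.
have phiV g : phi g^-1 = (phi g)^-1.
  by apply/esym/mulg1_eq; rewrite -gmulfM mulgV.
have phi_expgz g k : phi (expgz g k) = expgz (phi g) k.
  have phiX n : phi (g ^+ n) = phi g ^+ n.
    by elim: n => // n IHn; rewrite !expgS gmulfM IHn.
  by case: k => n; rewrite /expgz ?phiV phiX.
pose scale (p : S * int) := (p.1, (m p.1)%:Z * p.2)%R.
have phi_prod ws : phi (syl_prod (commutation_gen M) ws) =
    syl_prod (artin_gen M) [seq scale p | p <- ws].
  elim: ws => [|[s k] ws IHws]; first by rewrite /syl_prod !big_nil.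
  by rewrite !syl_prod_cons gmulfM IHws phi_expgz phi_gen expgzM.
have ker1 g : phi g = 1 -> g = 1.
  have [w <-] : exists w, syl_prod (commutation_gen M) w = g.
    exists [seq (l.1, if l.2 then (-1)%R else 1%R) | l <- repr g].
    rewrite /syl_prod big_map -[RHS]pres_class_repr pres_class_eval.
    by apply: eq_bigr => -[s []].
  have commuting_gen s t :
      commuting M s t -> commute (commutation_gen M s) (commutation_gen M t).
    move=> /eqP Mst; rewrite /commute -[LHS]pres_class_cat -[RHS]pres_class_cat.
    by apply/pres_classP/pres_eq_rel; exists s, t.
  have [[|[s k] ws] [<- nz gd]] := syl_prod_normal commuting_gen w.
    by rewrite /syl_prod big_nil.
  rewrite phi_prod => /syl_prod_artin_neq1[].
    elim: ws s gd {nz} => //= -[r l] ws IHws s.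
    by case: ifP => _ //; [exact: IHws | case/andP => -> /IHws].
  rewrite -[_ :: _]/(map scale ((s, k) :: ws)) all_map.
  apply: sub_all nz => -[r l] /=; rewrite -absz_eq0 abszM => l0.
  by have := hm r; case: `|l|%N l0 => // n _; rewrite mulnS; lia.
move=> g h gh; apply/divg1_eq/ker1.
by rewrite gmulfM phiV gh mulgV.
Qed.
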